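(* Let $\gamma\in\mathcal{M}_{n+1,n}$. Then there exists a unique smooth map $g=(p_1,\dots,p_{2n+1}):\mathbb{R}\to O(n+1,n)$ (with columns $p_i$) such that $p_i=\gamma_x^{(i-1)}$ for $1\le i\le n+1$ and $$g^{-1}g_x=b+\sum_{i=1}^n u_i\beta_i$$ for some smooth functions $u_1,\dots,u_n:\mathbb{R}\to\mathbb{R}$.
   Context: Let $n\ge 1$, let $e_{i,j}$ be the $(2n+1)\times(2n+1)$ elementary matrices, $C_n=\sum_{i=1}^{2n+1}(-1)^{n+i-1}e_{i,2n+2-i}$, and let $\mathbb{R}^{n+1,n}$ be $\mathbb{R}^{2n+1}$ with the bilinear form $\langle X,Y\rangle=X^tC_nY$. $O(n+1,n)$ is the group of real matrices $A$ with $A^tC_nA=C_n$. Put $b=\sum_{i=1}^{2n}e_{i+1,i}$ and $\beta_i=e_{n+1-i,n+i}+e_{n+2-i,n+1+i}$ for $1\le i\le n$. A smooth map $\gamma:\mathbb{R}\to\mathbb{R}^{n+1,n}$ is an isotropic curve if $\gamma,\gamma_s,\dots,\gamma_s^{(2n)}$ are linearly independent at every $s$ and the span of $\gamma,\gamma_s,\dots,\gamma_s^{(n-1)}$ is a maximal isotropic subspace for every $s$ (isotropic: $\langle X,Y\rangle=0$ for all $X,Y$ in the subspace). $\mathcal{M}_{n+1,n}$ is the set of isotropic curves $\gamma:\mathbb{R}\to\mathbb{R}^{n+1,n}$, $x\mapsto\gamma(x)$, with $\langle\gamma_x^{(n)},\gamma_x^{(n)}\rangle\equiv 1$. Here $\gamma_x^{(k)}$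 is the $k$-th derivative. *)

(* Defs.v *)
From HB Require Import structures.
From mathcomp Require Import all_boot all_order all_algebra.
From mathcomp Require Import all_classical all_reals all_analysis.
Set Implicit Arguments.
Unset Strict Implicit.
Unset Printing Implicit Defensive.
Import Order.TTheory GRing.Theory Num.Theory.
Import numFieldNormedType.Exports.
Local Open Scope ring_scope.

Definition smooth (R : realType) (V : normedModType R) (f : R -> V) : Prop :=
  forall (k : nat) (x : R), derivable (derive1n k f) x 1.

(* The indices i and j are 1-based, i.e. they range over 1, ..., 2n+1. *)
Definition e_mx (R : realType) (n i j : nat) : 'M[R]_((2 * n).+1) :=
  delta_mx (inord i.-1) (inord j.-1).

Definition C_mx (R : realType) (n : nat) : 'M[R]_((2 * n).+1) :=
  \sum_(1 <= i < (2 * n).+2)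
    (-1) ^+ (n + i - 1)%N *: e_mx R n i (2 * n + 2 - i)%N.

Definition b_mx (R : realType) (n : nat) : 'M[R]_((2 * n).+1) :=
  \sum_(1 <= i < (2 * n).+1) e_mx R n i.+1 i.

(* As in e_mx, the index i is 1-based: it ranges over 1, ..., n. *)
Definition beta_mx (R : realType) (n i : nat) : 'M[R]_((2 * n).+1) :=
  e_mx R n (n + 1 - i) (n + i) + e_mx R n (n + 2 - i) (n + 1 + i).

Definition bform (R : realType) (n : nat) (X Y : 'cV[R]_((2 * n).+1)) : R :=
  (X^T *m C_mx R n *m Y) ord0 ord0.

Definition in_O (R : realType) (n : nat) (A : 'M[R]_((2 * n).+1)) : Prop :=
  A^T *m C_mx R n *m A = C_mx R n.

Definition isotropic (R : realType) (n : nat)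
    (U : {vspace 'cV[R]_((2 * n).+1)}) : Prop :=
  forall X Y, X \in U -> Y \in U -> bform X Y = 0.

Definition maximal_isotropic (R : realType) (n : nat)
    (U : {vspace 'cV[R]_((2 * n).+1)}) : Prop :=
  isotropic U /\
  forall W : {vspace 'cV[R]_((2 * n).+1)},
    isotropic W -> (U <= W)%VS -> W = U.

(* The list f(x), f'(x), ..., f^(k-1)(x), of length k. *)
Definition jet (R : realType) (V : normedModType R) (f : R -> V) (k : nat)
    (x : R) : seq V :=
  [seq derive1n i f x | i <- iota 0 k].

Definition isotropic_curve (R : realType) (n : nat)
    (gamma : R -> 'cV[R]_((2 * n).+1)) : Prop :=
  [/\ smooth gamma,
      forall s, free (jet gamma (2 * n).+1 s)
    & forall s, maximal_isotropic <<jet gamma n s>>%VS].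

Definition in_M (R : realType) (n : nat)
    (gamma : R -> 'cV[R]_((2 * n).+1)) : Prop :=
  isotropic_curve gamma /\
  forall x, bform (derive1n n gamma x) (derive1n n gamma x) = 1.

(* Main.v *)
Require Import Defs.
From HB Require Import structures.
From mathcomp Require Import all_boot all_order all_algebra.
From mathcomp Require Import all_classical all_reals all_analysis.
From mathcomp Require Import zify ring lra.
Import Order.TTheory GRing.Theory Num.Theory.
Import numFieldNormedType.Exports.
Local Open Scope ring_scope.

(** Write [q k] for the column [p_(k+1)] of the frame, so that [q k] is the
    [k]-th derivative of the curve for [k <= n], and put [u 0 = u (n+1) = 0] and
    [q (2n+1) = 0]. Column by column, the equation
    [g^-1 g' = b + sum u_i beta_i] says that, for all [k <= 2n],

      [q k]' - u (k-n) [q (2n+1-k)] = [q (k+1)] + u (k+1-n) [q (2n-1-k)]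

    where differences of indices are truncated at 0, and [g] has values in
    O(n+1,n) if and only if [q j] and [q k] are orthogonal unless [j + k = 2n],
    in which case they pair to [(-1)^(n+j)].

    Suppose that [q 0, ..., q m] are known, with [n <= m < 2n], and that so are
    the coefficients up to [u (m-n)]. Then the left side [w] of the equation for
    [k = m] is known. Differentiating the constant pairings of [q m] with the
    other [q j] shows that [w] pairs with [q 0, ..., q m] exactly as [q (m+1)]
    has to ([residue_pairing]). The vector [q (2n-1-m)] to be subtracted is
    isotropic, orthogonal to all of [q 0, ..., q m] and pairs to a sign with
    [w]; hence one and only one multiple of it makes [q (m+1)] isotropic. This
    multiple is [u (m+1-n)]: the formula [null_coeff] for it gives uniqueness
    ([coeff_forced], [frame_unique]) and existence ([frame_extend],
    [frame_exists]). The recursion starts at [m = n], where the Gram matrix is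
    obtained from the isotropy of the osculating spaces and the normalization by
    differentiation. At the other end [m = 2n] there is no freedom left: [w] is
    orthogonal to the whole basis, so it vanishes ([frame_last_residue]), which
    is the last column of the matrix equation. *)

Set Implicit Arguments.
Unset Strict Implicit.
Unset Printing Implicit Defensive.

(** * Smooth functions of one real variable *)

(** Coinduction principle: iterated derivatives never have to be computed, it
    suffices to exhibit a class of functions stable under differentiation. *)
Lemma smooth_coind (R : realType) (V : normedModType R)
    (S : (R -> V) -> Prop) :
  (forall f, S f -> (forall x, derivable f x 1) /\ S (derive1 f)) ->
  forall f, S f -> smooth f.
Proof.
move=> SP f Sf k x; suff /SP[] : S (derive1n k f) by [].
by elim: k => [//|k /SP[_]].
Qed.

Lemma smooth_derivable (R : realType) (V : normedModType R) (f : R -> V) x :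
  smooth f -> derivable f x 1.
Proof. by move=> sf; exact: (sf 0%N). Qed.

Lemma smooth_derive1 (R : realType) (V : normedModType R) (f : R -> V) :
  smooth f -> smooth (derive1 f).
Proof. by move=> sf k x; rewrite -derive1Sn; exact: sf. Qed.

Lemma smooth_derive1n (R : realType) (V : normedModType R) (f : R -> V) k :
  smooth f -> smooth (derive1n k f).
Proof. by move=> sf; elim: k => [//|k]; exact: smooth_derive1. Qed.

Lemma smooth_cst (R : realType) (V : normedModType R) (a : V) :
  smooth (cst a : R -> V).
Proof.
apply: (@smooth_coind _ _ (fun f => exists a, f = cst a)); last by exists a.
move=> _ [c ->]; split; first by move=> x; exact: derivable_cst.
by exists 0; apply/funext => x; rewrite derive1_cst.
Qed.

(** The Leibniz rule turns the derivative of a product into a sum of products,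
    so sums and products have to be shown smooth simultaneously: this is the
    algebra that smooth functions generate. *)
Inductive smooth_alg (R : realType) : (R -> R) -> Prop :=
| SmoothAlgBase f : smooth f -> smooth_alg f
| SmoothAlgAdd f g : smooth_alg f -> smooth_alg g ->
    smooth_alg (fun x => f x + g x)
| SmoothAlgMul f g : smooth_alg f -> smooth_alg g ->
    smooth_alg (fun x => f x * g x).

Lemma smooth_algP (R : realType) (f : R -> R) : smooth_alg f -> smooth f.
Proof.
apply: smooth_coind => {f} f; elim=> {f} [f sf|f g _ [df Sf] _ [dg Sg]|
    f g Sf' [df Sf] Sg' [dg Sg]].
- split; first by move=> x; exact: smooth_derivable.
  by apply: SmoothAlgBase; exact: smooth_derive1.
- split; first by move=> x; exact: (derivableD (df x) (dg x)).
  rewrite (_ : derive1 _ = (fun x => derive1 f x + derive1 g x)).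
    exact: SmoothAlgAdd.
  by apply/funext => x; rewrite !derive1E (deriveD (df x) (dg x)).
- split; first by move=> x; exact: (derivableM (df x) (dg x)).
  rewrite (_ : derive1 _ = (fun x => f x * derive1 g x + g x * derive1 f x)).
    by apply: SmoothAlgAdd; apply: SmoothAlgMul.
  by apply/funext => x; rewrite !derive1E (deriveM (df x) (dg x)).
Qed.

Lemma smoothD (R : realType) (f g : R -> R) :
  smooth f -> smooth g -> smooth (fun x => f x + g x).
Proof.
by move=> sf sg; apply: smooth_algP; apply: SmoothAlgAdd; apply: SmoothAlgBase.
Qed.

Lemma smoothM (R : realType) (f g : R -> R) :
  smooth f -> smooth g -> smooth (fun x => f x * g x).
Proof.
by move=> sf sg; apply: smooth_algP; apply: SmoothAlgMul; apply: SmoothAlgBase.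
Qed.

Lemma smooth_sum (R : realType) (I : Type) (r : seq I) (f : I -> R -> R) :
  (forall i, smooth (f i)) -> smooth (fun x => \sum_(i <- r) f i x).
Proof.
move=> sf; elim: r => [|i r IHr].
  rewrite (_ : (fun _ => _) = cst 0); first exact: smooth_cst.
  by apply/funext => x; rewrite big_nil.
rewrite (_ : (fun _ => _) = (fun x => f i x + \sum_(j <- r) f j x)).
  exact: (smoothD (sf i) IHr).
by apply/funext => x; rewrite big_cons.
Qed.

Lemma derivable_entry (R : realType) p q (F : R -> 'M[R]_(p.+1, q.+1)) x i j :
  derivable F x 1 -> derivable (fun t => F t i j) x 1.
Proof. by move=> dF; apply: ((derivable_mxP _ _ _).1 dF i j). Qed.

Lemma derive1_mx (R : realType) p q (F : R -> 'M[R]_(p.+1, q.+1)) x i j :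
  derivable F x 1 -> derive1 F x i j = derive1 (fun t => F t i j) x.
Proof. by move=> dF; rewrite !derive1E derive_mx // mxE. Qed.

Lemma smooth_mxP (R : realType) p q (F : R -> 'M[R]_(p.+1, q.+1)) :
  smooth F <-> forall i j, smooth (fun x => F x i j).
Proof.
split=> [sF i j|].
  apply: (@smooth_coind _ _ (fun f => exists2 G : R -> 'M[R]_(p.+1, q.+1),
    smooth G & f = fun x => G x i j)); last by exists F.
  move=> _ [G sG ->].
  have dG x : derivable G x 1 by exact: smooth_derivable.
  split.
    by move=> x; exact: derivable_entry.
  exists (derive1 G); first exact: smooth_derive1.
  by apply/funext => x; rewrite derive1_mx.
apply: (@smooth_coind _ _ (fun G : R -> 'M[R]_(p.+1, q.+1) =>
  forall i j, smooth (fun x => G x i j))) => {}F sF.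
have dF x : derivable F x 1.
  apply: ((derivable_mxP F x 1).2) => i j.
  exact: (smooth_derivable (sF i j)).
split; first exact: dF.
move=> i j; suff -> : (fun x => derive1 F x i j) = derive1 (fun x => F x i j).
  exact: (smooth_derive1 (sF i j)).
by apply/funext => x; rewrite derive1_mx.
Qed.

Lemma smoothBZ (R : realType) p q (F G : R -> 'M[R]_(p.+1, q.+1)) (v : R -> R) :
  smooth F -> smooth v -> smooth G -> smooth (fun x => F x - v x *: G x).
Proof.
move=> /smooth_mxP sF sv /smooth_mxP sG; apply/smooth_mxP => i j.
suff -> : (fun x => (F x - v x *: G x) i j) =
    (fun x => F x i j + (fun=> -1) x * (v x * G x i j)).
  apply: (smoothD (sF i j)); apply: (@smoothM _ (fun=> -1)).
    exact: smooth_cst.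
  exact: (smoothM sv (sG i j)).
by apply/funext => x; rewrite !mxE mulN1r.
Qed.

(** * The bilinear form *)

Lemma C_mxE (R : realType) n (i j : 'I_(2 * n).+1) :
  C_mx R n i j = if (i + j == 2 * n)%N then (-1) ^+ (n + i) else 0.
Proof.
rewrite /C_mx big_add1 /= big_mkord summxE (bigD1 i) //= big1 ?addr0.
  rewrite !mxE /= inord_val eqxx /= addnS subn1 /=.
  have -> : (j == inord (2 * n + 2 - i.+1).-1) = (i + j == 2 * n)%N.
    by rewrite -val_eqE /= inordK; have := ltn_ord i; have := ltn_ord j; lia.
  by case: ifP; rewrite ?mulr1 ?mulr0.
move=> k kNi; rewrite !mxE /= inord_val eq_sym (negbTE kNi) /=.
by rewrite mulr0.
Qed.

Lemma C_mx_involutive (R : realType) n : C_mx R n *m C_mx R n = 1%:M.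
Proof.
apply/matrixP => i j; rewrite !mxE (bigD1 (rev_ord i)) //= big1 ?addr0.
  rewrite !C_mxE /= !subSS subnKC ?eqxx; last by rewrite -ltnS.
  have -> : (2 * n - i + j == 2 * n)%N = (i == j).
    by rewrite -val_eqE /=; have := ltn_ord i; have := ltn_ord j; lia.
  case: eqP => _; rewrite ?mulr0 ?mulr0n // -exprD.
  rewrite (_ : (_ + _)%N = (2 * (2 * n))%N); last by have := ltn_ord i; lia.
  by rewrite exprM sqrrN expr1n expr1n mulr1n.
move=> k kNi; rewrite C_mxE ifF ?mul0r //; apply/negP => /eqP ik.
by move/eqP: kNi; apply; apply: val_inj => /=; lia.
Qed.

(** Each coordinate pairs with its mirror image only, so no double sum
    remains. *)
Lemma bformE (R : realType) n (X Y : 'cV[R]_((2 * n).+1)) :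
  bform X Y =
  \sum_(i < (2 * n).+1) (-1) ^+ (n + i) * (X i ord0 * Y (rev_ord i) ord0).
Proof.
rewrite /bform -mulmxA mxE; apply: eq_bigr => i _.
rewrite !mxE (bigD1 (rev_ord i)) //= big1 ?addr0.
  rewrite C_mxE /= subSS subnKC ?eqxx; last by rewrite -ltnS.
  by rewrite mulrCA.
move=> k kNi; rewrite C_mxE ifF ?mul0r //; apply/negP => /eqP ik.
by move/eqP: kNi; apply; apply: val_inj => /=; lia.
Qed.

Lemma bformC (R : realType) n (X Y : 'cV[R]_((2 * n).+1)) :
  bform X Y = bform Y X.
Proof.
rewrite !bformE (reindex_inj rev_ord_inj) /=; apply: eq_bigr => i _.
rewrite rev_ordK [Y i _ * _]mulrC; congr (_ * _).
rewrite -signr_odd -[RHS]signr_odd; congr (_ ^+ _).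
by rewrite /= subSS !oddD oddB ?oddM // -ltnS.
Qed.

Lemma bformDl (R : realType) n (X Y Z : 'cV[R]_((2 * n).+1)) :
  bform (X + Y) Z = bform X Z + bform Y Z.
Proof. by rewrite /bform linearD /= !mulmxDl mxE. Qed.

Lemma bformZl (R : realType) n a (X Z : 'cV[R]_((2 * n).+1)) :
  bform (a *: X) Z = a * bform X Z.
Proof. by rewrite /bform linearZ /= -!scalemxAl mxE. Qed.

Lemma bformBl (R : realType) n (X Y Z : 'cV[R]_((2 * n).+1)) :
  bform (X - Y) Z = bform X Z - bform Y Z.
Proof. by rewrite -scaleN1r bformDl bformZl mulN1r. Qed.

Lemma bformDr (R : realType) n (X Y Z : 'cV[R]_((2 * n).+1)) :
  bform Z (X + Y) = bform Z X + bform Z Y.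
Proof. by rewrite ![bform Z _]bformC bformDl. Qed.

Lemma bformZr (R : realType) n a (X Z : 'cV[R]_((2 * n).+1)) :
  bform Z (a *: X) = a * bform Z X.
Proof. by rewrite ![bform Z _]bformC bformZl. Qed.

Lemma bformBr (R : realType) n (X Y Z : 'cV[R]_((2 * n).+1)) :
  bform Z (X - Y) = bform Z X - bform Z Y.
Proof. by rewrite ![bform Z _]bformC bformBl. Qed.

Lemma smooth_bform (R : realType) n (X Y : R -> 'cV[R]_((2 * n).+1)) :
  smooth X -> smooth Y -> smooth (fun x => bform (X x) (Y x)).
Proof.
move=> /smooth_mxP sX /smooth_mxP sY.
pose f (i : 'I_(2 * n).+1) (x : R) : R :=
  (-1) ^+ (n + i) * (X x i ord0 * Y x (rev_ord i) ord0).
have sf i : smooth (f i).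
  apply: (@smoothM _ (fun => (-1) ^+ (n + i))); first exact: smooth_cst.
  exact: (smoothM (sX i ord0) (sY (rev_ord i) ord0)).
suff -> : (fun x => bform (X x) (Y x)) =
    (fun x => \sum_(i <- index_enum 'I_(2 * n).+1) f i x).
  exact: smooth_sum.
by apply/funext => x; rewrite bformE.
Qed.

Lemma derive1_bform (R : realType) n (X Y : R -> 'cV[R]_((2 * n).+1)) x :
  derivable X x 1 -> derivable Y x 1 ->
  derive1 (fun t => bform (X t) (Y t)) x =
  bform (derive1 X x) (Y x) + bform (X x) (derive1 Y x).
Proof.
move=> dX dY.
have dXi i : derivable (fun t => X t i ord0) x 1 by exact: derivable_entry.
have dYi i : derivable (fun t => Y t i ord0) x 1 by exact: derivable_entry.
have -> : (fun t => bform (X t) (Y t)) =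
    \sum_(i < (2 * n).+1) ((-1) ^+ (n + i) \*:
       ((fun t => X t i ord0) * (fun t => Y t (rev_ord i) ord0))).
  by apply/funext => t; rewrite bformE fct_sumE; apply: eq_bigr.
have dXY i := derivableM (dXi i) (dYi (rev_ord i)).
rewrite derive1E derive_sum; last by move=> i; exact: derivableZ.
rewrite !bformE -big_split /=; apply: eq_bigr => i _.
rewrite (deriveZ _ (dXY i)) (deriveM (dXi i) (dYi (rev_ord i))).
rewrite -!derive1E -!derive1_mx // /GRing.scale /=; ring.
Qed.

(** A pairing that does not vary gives, by Leibniz, the integration by parts
    on which every computation with moving frames rests. *)
Lemma bform_derive1_cst (R : realType) n (X Y : R -> 'cV[R]_((2 * n).+1)) c x :
  smooth X -> smooth Y -> (forall t, bform (X t) (Y t) = c) ->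
  bform (derive1 X x) (Y x) = - bform (X x) (derive1 Y x).
Proof.
move=> sX sY XYc; apply/eqP; rewrite -addr_eq0.
rewrite -derive1_bform; [|exact: smooth_derivable..].
rewrite (_ : (fun t => _) = cst c); first by rewrite derive1_cst.
exact/funext.
Qed.

Lemma in_O_unit (R : realType) n (A : 'M[R]_((2 * n).+1)) :
  in_O A -> A \in unitmx.
Proof.
move=> OA; have : (C_mx R n *m A^T *m C_mx R n) *m A = 1%:M.
  by rewrite -!mulmxA [A^T *m _]mulmxA OA C_mx_involutive.
by case/mulmx1_unit.
Qed.

Lemma bform_col (R : realType) n (A B : 'M[R]_((2 * n).+1)) i j :
  bform (col i A) (col j B) = (A^T *m C_mx R n *m B) i j.
Proof.
by rewrite /bform tr_col -row_mul !mxE; apply: eq_bigr => k _; rewrite !mxE.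
Qed.

(** * Frames and their structure equations *)

(** The condition that the entry [(j, k)] of the Gram matrix puts on a frame
    for it to lie in the orthogonal group; indices start from 0, hence [j] and
    [2 * n - j] are mirror images. *)
Definition dual_pair (R : realType) n (q : nat -> R -> 'cV[R]_((2 * n).+1))
    (j k : nat) : Prop :=
  forall x, bform (q j x) (q k x) =
    if (j + k == 2 * n)%N then (-1) ^+ (n + j) else 0.

(** The derivative of the [k]-th vector, minus the term of its structure
    equation that earlier steps of the construction determine. With truncated
    subtraction and [u 0 = 0], the formula also covers [k <= n], where no such
    term exists. *)
Definition residue (R : realType) n (q : nat -> R -> 'cV[R]_((2 * n).+1))
    (u : nat -> R -> R) (k : nat) (x : R) : 'cV[R]_((2 * n).+1) :=
  derive1 (q k) x - u (k - n)%N x *: q ((2 * n).+1 - k)%N x.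

Definition structure_eq (R : realType) n (q : nat -> R -> 'cV[R]_((2 * n).+1))
    (u : nat -> R -> R) (k : nat) : Prop :=
  forall x, residue q u k x =
    q k.+1 x + u (k.+1 - n)%N x *: q (2 * n - k.+1)%N x.

(** The first [m + 1] vectors of a frame together with their structure
    equations; [m] is the stage that the recursive construction has reached. *)
Record partial_frame (R : realType) n (q : nat -> R -> 'cV[R]_((2 * n).+1))
    (u : nat -> R -> R) (m : nat) : Prop := PartialFrame {
  frame_smooth : forall k, smooth (q k);
  frame_coeff0 : forall x, u 0%N x = 0;
  frame_gram : forall j k, (j <= m)%N -> (k <= m)%N -> dual_pair q j k;
  frame_eq : forall k, (k < m)%N -> structure_eq q u k }.

Lemma frame_le (R : realType) n (q : nat -> R -> 'cV[R]_((2 * n).+1))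
    (u : nat -> R -> R) l m :
  partial_frame q u m -> (l <= m)%N -> partial_frame q u l.
Proof.
move=> [sq u0 gram eqs] le_lm; split=> // [j k le_j le_k|k lt_k].
  by apply: gram; apply: leq_trans le_lm.
by apply: eqs; apply: leq_trans le_lm.
Qed.

Lemma dual_pair_sym (R : realType) n (q : nat -> R -> 'cV[R]_((2 * n).+1)) j k :
  dual_pair q j k -> dual_pair q k j.
Proof.
move=> qjk x; rewrite bformC qjk addnC; case: eqP => // jk.
rewrite -signr_odd -[RHS]signr_odd; congr (_ ^+ _).
by lia.
Qed.

(** By Leibniz, pairing the derivative of [q m] with [q j] amounts to pairing
    [q m] with the derivative of [q j], which the structure equations express
    through the frame; the correction by [u (m - n)] cancels the one unwanted
    value, at [j = m - 1]. The case [m = 2 * n] is included, where the pairing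
    is always zero. *)
Lemma residue_pairing (R : realType) n (q : nat -> R -> 'cV[R]_((2 * n).+1))
    (u : nat -> R -> R) m :
  (n <= m <= 2 * n)%N -> partial_frame q u m ->
  forall j x, (j <= m)%N -> bform (residue q u m x) (q j x) =
    if (m.+1 + j == 2 * n)%N then (-1) ^+ (n + m.+1) else 0.
Proof.
move=> /andP[le_nm le_m2n] [sq u0 gram eqs] j x.
rewrite leq_eqVlt => /orP[/eqP -> {j}|lt_jm].
  rewrite /residue bformBl bformZl.
  have dmm := bform_derive1_cst x (sq m) (sq m) (gram m m (leqnn m) (leqnn m)).
  rewrite [RHS]ifF; last by apply/eqP; lia.
  have -> : bform (derive1 (q m) x) (q m x) = 0.
    by move: dmm; rewrite [in RHS]bformC; lra.
  have [-> |lt_nm] := eqVneq m n; first by rewrite subnn u0 mul0r subr0.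
  by rewrite gram; [rewrite ifF ?mulr0 ?subr0 //; apply/eqP; lia|lia|lia].
have le_jm := ltnW lt_jm.
rewrite /residue bformBl bformZl.
rewrite (bform_derive1_cst x (sq m) (sq j) (gram m j (leqnn m) le_jm)).
have -> : derive1 (q j) x = q j.+1 x + u (j.+1 - n)%N x *: q (2 * n - j.+1)%N x
    + u (j - n)%N x *: q ((2 * n).+1 - j)%N x.
  by rewrite -(eqs j lt_jm x) /residue subrK.
rewrite !bformDr !bformZr (gram m j.+1) //.
have -> : u (j - n)%N x * bform (q m x) (q ((2 * n).+1 - j)%N x) = 0.
  have [le_jn|lt_nj] := leqP j n.
    by rewrite (_ : j - n = 0)%N ?u0 ?mul0r //; lia.
  by rewrite gram; [rewrite ifF ?mulr0 //; apply/eqP; lia|lia|lia].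
have -> : u (j.+1 - n)%N x * bform (q m x) (q (2 * n - j.+1)%N x) =
    if (j.+1 == m)%N then u (m - n)%N x * (-1) ^+ (n + m) else 0.
  have [le_jn|lt_nj] := leqP j.+1 n.
    rewrite (_ : j.+1 - n = 0)%N ?u0 ?mul0r //; last by lia.
    by case: eqP => // jm; rewrite (_ : m - n = 0)%N ?u0 ?mul0r //; lia.
  rewrite gram; [|lia|lia].
  rewrite (_ : (m + (2 * n - j.+1) == 2 * n)%N = (j.+1 == m)); last by lia.
  by case: eqP => [<-|_]; rewrite ?mulr0.
have -> : u (m - n)%N x * bform (q ((2 * n).+1 - m)%N x) (q j x) =
    if (j.+1 == m)%N then - (u (m - n)%N x * (-1) ^+ (n + m)) else 0.
  have [-> |neq_mn] := eqVneq m n.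
    by rewrite subnn u0 !mul0r oppr0; case: ifP.
  rewrite bformC gram; [|lia|lia].
  rewrite (_ : (j + ((2 * n).+1 - m) == 2 * n)%N = (j.+1 == m)); last by lia.
  by case: eqP => [<-|_]; rewrite ?mulr0 // addnS exprS mulN1r mulrN opprK.
rewrite (_ : (m.+1 + j)%N = (m + j.+1)%N); last by lia.
rewrite [(n + m.+1)%N]addnS exprS mulN1r.
by case: ifP => _; case: ifP => _; ring.
Qed.

(** Subtracting the right multiple of an isotropic vector makes a vector
    isotropic; [k] is the index that the result gets in the frame. *)
Definition null_coeff (R : realType) n (k : nat)
    (w : 'cV[R]_((2 * n).+1)) : R :=
  (-1) ^+ (n + k) * bform w w / 2.

(** Expand the square of the structure equation: the next vector is isotropic,
    so is the one that it is mirrored to, and they pair to a sign. *)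
Lemma coeff_forced (R : realType) n (q : nat -> R -> 'cV[R]_((2 * n).+1))
    (u : nat -> R -> R) m x :
  (n <= m < 2 * n)%N -> partial_frame q u m.+1 ->
  u (m.+1 - n)%N x = null_coeff m.+1 (residue q u m x).
Proof.
move=> /andP[le_nm lt_m2n] [_ _ gram eqs].
rewrite /null_coeff (eqs m (ltnSn m) x) !(bformDl, bformDr, bformZl, bformZr).
rewrite [bform (q (2 * n - m.+1)%N x) (q m.+1 x)]bformC.
rewrite (gram m.+1 m.+1) // ifF; last by apply/eqP; lia.
rewrite (gram m.+1 (2 * n - m.+1)%N) //; last by lia.
rewrite ifT; last by apply/eqP; lia.
rewrite (gram (2 * n - m.+1) (2 * n - m.+1))%N; [|lia|lia].
rewrite ifF; last by apply/eqP; lia.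
have : (-1) ^+ (n + m.+1) * (-1) ^+ (n + m.+1) = 1 :> R.
  by rewrite -expr2 sqrr_sign.
set e := (-1) ^+ _; set v := u _ _ => ee.
have -> : e * (0 + v * e + (v * e + v * (v * 0))) / 2 = v * (e * e) by field.
by rewrite ee mulr1.
Qed.

(** Vectors and coefficients have to be compared together: the residue at
    stage [n + d] involves the coefficients up to [d], and it determines the
    coefficient of index [d + 1] and hence the next vector. *)
Lemma frame_unique (R : realType) n (q q' : nat -> R -> 'cV[R]_((2 * n).+1))
    (u u' : nat -> R -> R) :
  partial_frame q u (2 * n) -> partial_frame q' u' (2 * n) ->
  (forall k, (k <= n)%N -> q k = q' k) ->
  forall k, (k <= 2 * n)%N -> q k = q' k.
Proof.
move=> F F' qq'.
suff H d : (d <= n)%N -> (forall k, (k <= n + d)%N -> q k = q' k) /\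
    (forall j, (j <= d)%N -> u j = u' j).
  by move=> k le_k; apply: (proj1 (H n (leqnn n))); rewrite addnn -mul2n.
elim: d => [|d IHd] le_dn.
  split=> [k|j]; first by rewrite addn0; exact: qq'.
  rewrite leqn0 => /eqP ->; apply/funext => x.
  by rewrite (frame_coeff0 F) (frame_coeff0 F').
have [IHq IHu] := IHd (ltnW le_dn).
have eq_res x : residue q u (n + d) x = residue q' u' (n + d) x.
  rewrite /residue IHq // addKn IHu //; congr (_ - _).
  (* for d = 0 the vector of index n + 1 is not yet known to be common *)
  have [d0|d_gt0] := posnP d; first by rewrite d0 (frame_coeff0 F') !scale0r.
  by rewrite IHq //; lia.
have Em : ((n + d).+1 - n = d.+1)%N by lia.
have Hm : (n <= n + d < 2 * n)%N by lia.
have eq_u : u d.+1 = u' d.+1.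
  apply/funext => x; rewrite -Em.
  rewrite (@coeff_forced _ _ q) //; last by apply: (frame_le F); lia.
  rewrite (@coeff_forced _ _ q') //; last by apply: (frame_le F'); lia.
  by rewrite eq_res.
split=> [k|j]; rewrite leq_eqVlt => /orP[/eqP -> |lt]; last 2 first.
- exact: eq_u.
- exact: IHu.
- apply/funext => x; rewrite addnS.
  have lt_nd : (n + d < 2 * n)%N by lia.
  have := frame_eq F lt_nd x; rewrite eq_res (frame_eq F' lt_nd x) Em eq_u.
  by rewrite (IHq (2 * n - (n + d).+1)%N); [move/addIr|lia].
- by apply: IHq; lia.
Qed.

(** The residue already has the right pairings with the earlier vectors;
    [null_coeff] makes it isotropic without disturbing them, because the vector
    subtracted is orthogonal to all of these. *)
Lemma frame_extend (R : realType) n (q : nat -> R -> 'cV[R]_((2 * n).+1))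
    (u : nat -> R -> R) m :
  (n <= m < 2 * n)%N -> partial_frame q u m -> (forall j, smooth (u j)) ->
  exists q' u', [/\ partial_frame q' u' m.+1, forall j, smooth (u' j),
    forall k, k != m.+1 -> q' k = q k &
    forall j, j != (m.+1 - n)%N -> u' j = u j].
Proof.
move=> Hm F su; have /andP[le_nm lt_m2n] := Hm.
have [sq u0 gram eqs] := F.
pose w := residue q u m.
pose v x := null_coeff m.+1 (w x).
pose l := (2 * n - m.+1)%N.
pose p x := w x - v x *: q l x.
have le_lm : (l <= m)%N by rewrite /l; lia.
have sw : smooth w.
  exact: (smoothBZ (smooth_derive1 (sq m)) (su (m - n)%N) (sq _)).
have sv : smooth v.
  suff -> : v = (fun x => bform (w x) (w x) *
      (fun=> (-1) ^+ (n + m.+1) / 2) x).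
    by apply: smoothM; [exact: smooth_bform|exact: smooth_cst].
  by apply/funext => x; rewrite /v /null_coeff mulrAC mulrC.
have sp : smooth p := smoothBZ sw sv (sq l).
have wq j x : (j <= m)%N -> bform (w x) (q j x) =
    if (m.+1 + j == 2 * n)%N then (-1) ^+ (n + m.+1) else 0.
  by apply: residue_pairing => //; lia.
have pq j x : (j <= m)%N -> bform (p x) (q j x) =
    if (m.+1 + j == 2 * n)%N then (-1) ^+ (n + m.+1) else 0.
  move=> le_jm; rewrite /p bformBl bformZl wq // gram // [X in _ * X]ifF.
    by rewrite mulr0 subr0.
  by apply/eqP; rewrite /l; lia.
have wl x : bform (w x) (q l x) = (-1) ^+ (n + m.+1).
  by rewrite wq // ifT //; apply/eqP; rewrite /l; lia.
have pp x : bform (p x) (p x) = 0.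
  rewrite {2}/p bformBr bformZr pq // [X in _ * X]ifT; last first.
    by apply/eqP; rewrite /l; lia.
  rewrite bformC /p bformBr bformZr wl /v /null_coeff.
  set e := (-1) ^+ _; have ee : e * e = 1 :> R by rewrite -expr2 sqrr_sign.
  set t := bform _ _.
  have -> : t - e * t / 2 * e - e * t / 2 * e = t * (1 - e * e) by field.
  by rewrite ee subrr mulr0.
pose q' k := if k == m.+1 then p else q k.
pose u' j := if j == (m.+1 - n)%N then v else u j.
have q'E k : (k <= m)%N -> q' k = q k by rewrite /q'; case: eqP => // ->; lia.
have q'S : q' m.+1 = p by rewrite /q' eqxx.
have u'E j : (j <= m - n)%N -> u' j = u j by rewrite /u'; case: eqP => //; lia.
exists q', u'; split; last 3 first.
- by move=> j; rewrite /u'; case: eqP => _; [exact: sv|exact: (su j)].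
- by move=> k; rewrite /q' => /negbTE ->.
- by move=> j; rewrite /u' => /negbTE ->.
have q'SP j : (j <= m.+1)%N -> dual_pair q' m.+1 j.
  move=> + x; rewrite leq_eqVlt => /orP[/eqP -> |le_jm].
    by rewrite q'S pp ifF //; apply/eqP; lia.
  by rewrite q'S q'E // pq.
split.
- by move=> k; rewrite /q'; case: eqP => _; [exact: sp|exact: (sq k)].
- by move=> x; rewrite u'E.
- move=> j k; rewrite leq_eqVlt => /orP[/eqP -> |le_jm]; first exact: q'SP.
  rewrite leq_eqVlt => /orP[/eqP -> |le_km].
    by apply: dual_pair_sym; apply: q'SP; lia.
  by move=> x; rewrite !q'E //; exact: gram.
- have resE k x : (k <= m)%N -> residue q' u' k x = residue q u k x.
    move=> le_km; rewrite /residue q'E // u'E; last by lia.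
    have [le_kn|lt_nk] := leqP k n.
      by rewrite (_ : k - n = 0)%N ?u0 ?scale0r //; lia.
    by rewrite [q' (_ - _)%N]q'E //; lia.
  move=> k; rewrite ltnS leq_eqVlt => /orP[/eqP -> |lt_km] x.
    by rewrite resE // q'S q'E // /p /u' eqxx subrK.
  rewrite resE; last exact: ltnW.
  rewrite eqs // q'E // u'E; last by lia.
  have [le_kn|lt_nk] := leqP k.+1 n.
    by rewrite (_ : k.+1 - n = 0)%N ?u0 ?scale0r //; lia.
  by rewrite q'E //; lia.
Qed.

Definition frame_mx (R : realType) n (q : nat -> R -> 'cV[R]_((2 * n).+1))
    (x : R) : 'M[R]_((2 * n).+1) := \matrix_(i, j) q j x i ord0.

Lemma col_frame_mx (R : realType) n (q : nat -> R -> 'cV[R]_((2 * n).+1)) x k :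
  (k < (2 * n).+1)%N -> col (inord k) (frame_mx q x) = q k x.
Proof.
by move=> lt_k; apply/colP => i; rewrite !mxE inordK.
Qed.

Lemma in_O_dual_pair (R : realType) n (q : nat -> R -> 'cV[R]_((2 * n).+1))
    (g : R -> 'M[R]_((2 * n).+1)) :
  (forall k x, (k <= 2 * n)%N -> col (inord k) (g x) = q k x) ->
  (forall x, in_O (g x)) <->
  (forall j k, (j <= 2 * n)%N -> (k <= 2 * n)%N -> dual_pair q j k).
Proof.
move=> gq; split=> [Og j k le_j le_k x|gram x].
  by rewrite -!gq // bform_col Og C_mxE !inordK.
apply/matrixP => i j; rewrite -bform_col C_mxE.
rewrite -[i in LHS]inord_val -[j in LHS]inord_val.
by rewrite !gq ?gram // -ltnS.
Qed.

(** A complete frame is the list of columns of an invertible matrix. *)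
Lemma frame_nondegenerate (R : realType) n
    (q : nat -> R -> 'cV[R]_((2 * n).+1)) (u : nat -> R -> R) w x :
  partial_frame q u (2 * n) ->
  (forall j, (j <= 2 * n)%N -> bform w (q j x) = 0) -> w = 0.
Proof.
move=> F wq0.
have Og : in_O (frame_mx q x).
  apply: ((in_O_dual_pair _).2 (frame_gram F) x) => k y le_k.
  exact: col_frame_mx.
have wCg : w^T *m C_mx R n *m frame_mx q x = 0.
  apply/matrixP => i j; have := wq0 j; rewrite -ltnS ltn_ord => /(_ isT).
  rewrite -col_frame_mx // inord_val /bform mxE => wgj.
  rewrite [RHS]mxE mxE -[RHS]wgj ord1; apply: eq_bigr => k _.
  by rewrite [col _ _ _ _]mxE.
apply: trmx_inj; rewrite trmx0 -[LHS]mulmx1 -(C_mx_involutive R n) mulmxA.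
by rewrite -(mulmxK (in_O_unit Og) (w^T *m _)) wCg !mul0mx.
Qed.

Lemma frame_last_residue (R : realType) n
    (q : nat -> R -> 'cV[R]_((2 * n).+1)) (u : nat -> R -> R) x :
  partial_frame q u (2 * n) -> residue q u (2 * n) x = 0.
Proof.
move=> F; apply: (frame_nondegenerate F (x := x)) => j le_j.
by rewrite residue_pairing //; [rewrite ifF //; apply/eqP; lia|lia].
Qed.

(** The vectors beyond the stage reached and the coefficients not yet chosen
    are kept at zero, so that the last structure equation, at [2 * n], has the
    same form as the others. *)
Lemma frame_exists (R : realType) n (gamma : R -> 'cV[R]_((2 * n).+1)) :
  in_M gamma ->
  exists q u, [/\ partial_frame q u (2 * n), forall j, smooth (u j),
    forall k, (k <= n)%N -> q k = derive1n k gamma,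
    forall k, (2 * n < k)%N -> q k = fun=> 0 &
    forall j, (n < j)%N -> u j = fun=> 0].
Proof.
move=> [[sgamma _ iso] norm1].
suff H d : (d <= n)%N -> exists q u,
    [/\ partial_frame q u (n + d), forall j, smooth (u j),
    forall k, (k <= n)%N -> q k = derive1n k gamma,
    forall k, (n + d < k)%N -> q k = fun=> 0 &
    forall j, (d < j)%N -> u j = fun=> 0].
  by have := H n (leqnn n); rewrite addnn -mul2n.
elim: d => [_|d IHd lt_dn]; last first.
  have [q [u [F su qg q0 u0]]] := IHd (ltnW lt_dn).
  have [|q' [u' [F' su' qq' uu']]] := frame_extend _ F su; first by lia.
  exists q', u'; rewrite addnS; split=> // [k le_kn|k lt_k|j lt_j].
  - by rewrite qq' ?qg //; apply/eqP; lia.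
  - by rewrite qq' ?q0 //; [lia|apply/eqP; lia].
  - by rewrite uu' ?u0 //; [lia|apply/eqP; lia].
pose q k := if (k <= n)%N then derive1n k gamma else fun=> 0.
have sgk k : smooth (derive1n k gamma) by exact: smooth_derive1n.
have qE k : (k <= n)%N -> q k = derive1n k gamma by rewrite /q => ->.
(* the Gram matrix of gamma and its first n derivatives *)
have giso j k x : (j < n)%N -> (k < n)%N ->
    bform (derive1n j gamma x) (derive1n k gamma x) = 0.
  move=> lt_j lt_k; apply: (proj1 (iso x)); apply: memv_span; apply/mapP.
    by exists j; rewrite // mem_iota.
  by exists k; rewrite // mem_iota.
have gtop j x : (j < n)%N ->
    bform (derive1n j gamma x) (derive1n n gamma x) = 0.
  case: n => [//|n'] in gamma sgamma iso norm1 q sgk qE giso *.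
  rewrite ltnS => le_jn.
  have := bform_derive1_cst x (sgk j) (sgk n')
    (fun t => giso j n' t le_jn (ltnSn n')).
  rewrite -!derive1nS => parts.
  move: le_jn; rewrite leq_eqVlt => /orP[/eqP jn|lt_jn].
    by move: parts; rewrite jn [in LHS]bformC; lra.
  by rewrite -[LHS]opprK -parts giso ?oppr0.
exists q, (fun _ _ => 0); rewrite addn0; split.
- split.
  + by move=> k; rewrite /q; case: ifP => _; [exact: sgk|exact: smooth_cst].
  + by [].
  + move=> j k le_j le_k x; rewrite !qE //.
    have [->|jn] := eqVneq j n; have [->|kn] := eqVneq k n.
    * rewrite norm1 ifT ?mul2n ?addnn ?eqxx //.
      by rewrite -mul2n exprM sqrrN !expr1n.
    * by rewrite bformC gtop ?ifF //; [apply/eqP; lia|lia].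
    * by rewrite gtop ?ifF //; [apply/eqP; lia|lia].
    * by rewrite giso ?ifF //; [apply/eqP; lia|lia|lia].
  + move=> k lt_kn x; rewrite /residue !scale0r subr0 addr0 !qE //.
    by exact: ltnW.
- by move=> j; exact: smooth_cst.
- by [].
- by move=> k; rewrite /q ltnNge => /negbTE ->.
- by [].
Qed.

(** * The connection matrix *)

(** The zero beyond the last column stands for the vector [q (2n+1)] of the
    structure equations. *)
Definition colz (R : realType) n (A : 'M[R]_((2 * n).+1)) (k : nat) :=
  if (k < (2 * n).+1)%N then col (inord k) A else 0.

(** Shifts the indices to start from 1 and extends by zero on both sides; the
    sum has at most one term. *)
Definition coeffz (R : realType) n (u : 'I_n -> R) (j : nat) : R :=
  \sum_(i < n | i.+1 == j) u i.

Lemma coeffz0 (R : realType) n (u : 'I_n -> R) : coeffz u 0 = 0.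
Proof. by rewrite /coeffz big1. Qed.

Lemma coeffzS (R : realType) n (u : 'I_n -> R) (i : 'I_n) :
  coeffz u i.+1 = u i.
Proof. by rewrite /coeffz (big_pred1 i) // => j; rewrite eqSS -val_eqE. Qed.

Lemma col_mul_delta (R : realType) m (A : 'M[R]_m) (r c k : 'I_m) :
  col k (A *m delta_mx r c) = (c == k)%:R *: col r A.
Proof.
apply/colP => i; rewrite !mxE (bigD1 r) //= big1 ?addr0.
  by rewrite !mxE eqxx /= eq_sym mulrC.
by move=> j /negbTE jr; rewrite !mxE jr mulr0.
Qed.

Lemma inord_eq n i j : (i < n.+1)%N -> (j < n.+1)%N ->
  (inord i == inord j :> 'I_n.+1) = (i == j).
Proof. by move=> lt_i lt_j; rewrite -val_eqE /= !inordK. Qed.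

Definition connection (R : realType) n (u : 'I_n -> R) : 'M[R]_((2 * n).+1) :=
  b_mx R n + \sum_(i < n) u i *: beta_mx R n i.+1.

(** Read column by column, the two entries of each [beta_mx] become the two
    coefficient terms of the structure equation. *)
Lemma col_mul_connection (R : realType) n (A : 'M[R]_((2 * n).+1))
    (u : 'I_n -> R) k : (k <= 2 * n)%N ->
  col (inord k) (A *m connection u) =
  colz A k.+1 + coeffz u (k.+1 - n) *: colz A (2 * n - k.+1)
    + coeffz u (k - n) *: colz A ((2 * n).+1 - k).
Proof.
move=> le_k; rewrite /connection mulmxDr linearD /= -addrA; congr (_ + _).
  rewrite /b_mx big_add1 /= big_mkord mulmx_sumr linear_sum /= /colz ltnS.
  have -> : \sum_(i < 2 * n) col (inord k) (A *m e_mx R n i.+2 i.+1) =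
      \sum_(i < 2 * n | (i == k :> nat)) col (inord k.+1) A.
    rewrite [RHS]big_mkcond; apply: eq_bigr => i _.
    rewrite /e_mx col_mul_delta /= inord_eq //; last by have := ltn_ord i; lia.
    by case: eqP => [->|_]; rewrite ?scale1r ?scale0r.
  case: ifP => [lt_k|le_nk].
    by rewrite (big_pred1 (Ordinal lt_k)) // => i; rewrite -val_eqE.
  by rewrite big1 // => i /eqP ik; have := ltn_ord i; lia.
rewrite mulmx_sumr linear_sum /= /coeffz !scaler_suml.
rewrite [X in _ = X + _]big_mkcond [X in _ = _ + X]big_mkcond -big_split /=.
apply: eq_bigr => i _.
have lt_i := ltn_ord i.
rewrite -scalemxAr linearZ /= /beta_mx mulmxDr linearD /= /e_mx !col_mul_delta.
rewrite !inord_eq; [|lia..].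
rewrite scalerDr; congr (_ + _).
  rewrite (_ : (_ == k) = (i.+1 == k.+1 - n)%N); last by apply/eqP/eqP; lia.
  case: eqP => Ei; last by rewrite scale0r scaler0.
  rewrite scale1r /colz ifT; last by lia.
  by congr (_ *: col (inord _) A); lia.
rewrite (_ : (_ == k) = (i.+1 == k - n)%N); last by apply/eqP/eqP; lia.
case: eqP => Ei; last by rewrite scale0r scaler0.
rewrite scale1r /colz ifT; last by lia.
by congr (_ *: col (inord _) A); lia.
Qed.

Lemma col_derive1 (R : realType) m (g : R -> 'M[R]_m.+1) k x :
  derivable g x 1 ->
  col k (derive1 g x) = derive1 (fun t => col k (g t)) x.
Proof.
move=> dg.
have colE' r s : (fun t => col k (g t) r s) = (fun t => g t r k).
  by apply/funext => t; rewrite mxE.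
have dcol : derivable (fun t => col k (g t)) x 1.
  apply: ((derivable_mxP _ _ _).2) => r s; rewrite colE'.
  exact: derivable_entry.
apply/colP => i; rewrite mxE (derive1_mx _ _ dg) (derive1_mx _ _ dcol).
by rewrite colE'.
Qed.

Definition columns (R : realType) n (g : R -> 'M[R]_((2 * n).+1)) (k : nat)
    (x : R) : 'cV[R]_((2 * n).+1) := colz (g x) k.

Definition coeffs (R : realType) n (u : 'I_n -> R -> R) (j : nat) (x : R) : R :=
  coeffz (u^~ x) j.

Lemma smooth_columns (R : realType) n (g : R -> 'M[R]_((2 * n).+1)) k :
  smooth g -> smooth (columns g k).
Proof.
move=> /smooth_mxP sg; apply/smooth_mxP => i j; rewrite /columns /colz.
case: (k < _)%N.
  suff -> : (fun x => col (inord k) (g x) i j) = (fun x => g x i (inord k)).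
    exact: sg.
  by apply/funext => x; rewrite mxE.
suff -> : (fun _ : R => (0 : 'cV[R]_((2 * n).+1)) i j) = (fun=> 0).
  exact: smooth_cst.
by apply/funext => x; rewrite mxE.
Qed.

Lemma columnsE (R : realType) n (g : R -> 'M[R]_((2 * n).+1)) k x :
  (k <= 2 * n)%N -> columns g k x = col (inord k) (g x).
Proof. by move=> le_k; rewrite /columns /colz ltnS le_k. Qed.

Lemma connectionP (R : realType) n (g : R -> 'M[R]_((2 * n).+1))
    (u : 'I_n -> R -> R) :
  smooth g -> (forall x, in_O (g x)) ->
  (forall x, invmx (g x) *m derive1 g x = connection (u^~ x)) <->
  (forall k, (k <= 2 * n)%N -> structure_eq (columns g) (coeffs u) k).
Proof.
move=> sg Og.
have dg x : derivable g x 1 by exact: smooth_derivable.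
have gE x : invmx (g x) *m derive1 g x = connection (u^~ x) <->
    derive1 g x = g x *m connection (u^~ x).
  split=> [<-|->]; first by rewrite mulKVmx // in_O_unit.
  by rewrite mulKmx // in_O_unit.
have colE' k x : (k <= 2 * n)%N ->
    derive1 (columns g k) x = col (inord k) (derive1 g x).
  move=> le_k; rewrite (col_derive1 _ (dg x)).
  suff -> : columns g k = (fun t => col (inord k) (g t)) by [].
  by apply/funext => t; rewrite columnsE.
split=> [H k le_k x|H x].
  rewrite /residue colE' // (gE x).1 // col_mul_connection //.
  by rewrite addrK.
apply/gE/matrixP => i j.
have le_j : (j <= 2 * n)%N by rewrite -ltnS.
suff : col j (derive1 g x) = col j (g x *m connection (u^~ x)).
  by move/colP => /(_ i); rewrite !mxE.
rewrite -[j]inord_val col_mul_connection // -colE' //.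
by have := H j le_j x => /eqP; rewrite /residue subr_eq => /eqP.
Qed.

(** * The adapted frame of an isotropic curve *)

Unset Implicit Arguments.

Theorem theorem2p3 (R : realType) (n : nat) (n_ge1 : (1 <= n)%N)
    (gamma : R -> 'cV[R]_((2 * n).+1)) (gammaM : in_M gamma) :
  exists! g : R -> 'M[R]_((2 * n).+1),
    [/\ smooth g,
        forall x, in_O (g x),
        forall (x : R) (i : nat), (1 <= i <= n + 1)%N ->
          col (inord i.-1) (g x) = derive1n i.-1 gamma x
      & exists u : 'I_n -> R -> R,
          (forall i, smooth (u i)) /\
          forall x, invmx (g x) *m derive1 g x =
            b_mx R n + \sum_(i < n) u i x *: beta_mx R n i.+1].
Proof.
have [q [u [F su qg q0 u0]]] := frame_exists gammaM.
have columns_frame (g : R -> 'M[R]_((2 * n).+1)) (v : 'I_n -> R -> R) :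
    smooth g -> (forall x, in_O (g x)) ->
    (forall x, invmx (g x) *m derive1 g x = connection (v^~ x)) ->
    partial_frame (columns g) (coeffs v) (2 * n).
  move=> sg Og /(connectionP v sg Og) gv; split.
  - by move=> k; exact: smooth_columns.
  - by move=> x; exact: coeffz0.
  - by apply: (in_O_dual_pair _).1 Og => k x le_k; rewrite columnsE.
  - by move=> k /ltnW; exact: gv.
exists (frame_mx q).
have colsq : columns (frame_mx q) = q.
  apply/funext => k; apply/funext => x; rewrite /columns /colz.
  by case: ltnP => [/col_frame_mx -> //|lt_k]; rewrite q0.
have Fu : coeffs (fun i : 'I_n => u i.+1) = u.
  apply/funext => -[|j]; apply/funext => x.
    by rewrite /coeffs coeffz0 (frame_coeff0 F).
  have [le_n|lt_n] := leqP n j.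
    rewrite u0 // /coeffs /coeffz big1 // => i /eqP[ij].
    by have := ltn_ord i; rewrite ij ltnNge le_n.
  exact: (coeffzS (fun i : 'I_n => u i.+1 x) (Ordinal lt_n)).
have sg : smooth (frame_mx q).
  apply/smooth_mxP => i j.
  suff -> : (fun x => frame_mx q x i j) = (fun x => q j x i ord0).
    have [sq _ _ _] := F; have /smooth_mxP sqj : smooth (q j) by exact: sq.
    exact: (sqj i ord0).
  by apply/funext => x; rewrite mxE.
have Og : forall x, in_O (frame_mx q x).
  apply: (in_O_dual_pair _).2 (frame_gram F) => k x le_k.
  exact: col_frame_mx.
split.
  split=> //.
  - move=> x i /andP[i_gt0 le_i].
    by rewrite col_frame_mx ?qg //; lia.
  - exists (fun i : 'I_n => u i.+1); split; first by move=> i; exact: su.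
    apply/(connectionP (fun i : 'I_n => u i.+1) sg Og) => k.
    rewrite colsq Fu leq_eqVlt => /orP[/eqP -> x|]; last exact: (frame_eq F).
    rewrite (frame_last_residue x F) q0 // (u0 (_ - _)%N); last by lia.
    by rewrite scale0r addr0.
move=> g [sg' Og' gcol [v [sv gv]]].
have eqcol := frame_unique F (columns_frame g v sg' Og' gv).
apply/funext => x; apply/matrixP => i j.
have le_j : (j <= 2 * n)%N by rewrite -ltnS.
have := eqcol _ j le_j; rewrite mxE => -> //.
  by rewrite columnsE // inord_val mxE.
move=> k le_k; rewrite qg //; apply/funext => y; rewrite columnsE; last by lia.
by rewrite -(gcol y k.+1) //=; lia.
Qed.
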